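(* Let $G$ be a finite group. Then the following statements are equivalent: (1) Whenever $p\in\pi(G)$ and $H\leq K$ are two $p$-subgroups of $G$, $H$ is SS-permutable in $N_G(K)$. (2) Whenever $p\in\pi(G)$ and $H\leq K$ are two $p$-subgroups of $G$, $H$ is NSS-permutable in $N_G(K)$. (3) $G$ is a solvable PST-group.
   Context: All groups are finite; $\pi(G)$ is the set of prime divisors of $|G|$. Two subgroups $A,B$ of a group permute if $AB=BA$. A supplement of $H$ in $G$ is a subgroup $K\le G$ with $G=HK$. A subgroup $H$ of a group $G$ is SS-permutable in $G$ if $H$ has a supplement $K$ in $G$ such that $H$ permutes with every Sylow subgroup of $K$ (for all primes). $H$ is NSS-permutable in $G$ if $H$ has such a supplement $K$ which is moreover normal in $G$. A subgroup is S-permutable in $G$ if it permutes with all Sylow subgroups of $G$. $G$ is a PST-group if S-permutability is transitive: whenever $H\le K\le G$, $H$ is S-permutable in $K$ and $K$ is S-permutable in $G$, then $H$ is S-permutable in $G$. *)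

(* Defs.v *)
From mathcomp Require Import all_boot all_fingroup all_solvable.

Set Implicit Arguments.
Unset Strict Implicit.
Unset Printing Implicit Defensive.

Local Open Scope group_scope.

(* "A and B permute", i.e. AB = BA, is MathComp's [commute] taken in the monoid
   of subsets of gT, where A * B is the elementwise product. *)
Definition permute (gT : finGroupType) (A B : {group gT}) : Prop :=
  commute (A : {set gT}) (B : {set gT}).

(* [Sylow G P] means that P is a Sylow p-subgroup of G for some prime p. *)
Definition permutes_with_Sylows (gT : finGroupType) (G H : {group gT}) : Prop :=
  forall P : {group gT}, Sylow G P -> permute H P.

Definition supplement (gT : finGroupType) (G H K : {group gT}) : Prop :=
  K \subset G /\ H * K = G.

Definition S_permutable (gT : finGroupType) (G H : {group gT}) : Prop :=
  H \subset G /\ permutes_with_Sylows G H.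

Definition SS_permutable (gT : finGroupType) (G H : {group gT}) : Prop :=
  H \subset G /\
  exists K : {group gT}, supplement G H K /\ permutes_with_Sylows K H.

Definition NSS_permutable (gT : finGroupType) (G H : {group gT}) : Prop :=
  H \subset G /\
  exists K : {group gT},
    [/\ K <| G, supplement G H K & permutes_with_Sylows K H].

Definition PST_group (gT : finGroupType) (G : {group gT}) : Prop :=
  forall H K : {group gT}, H \subset K -> K \subset G ->
    S_permutable K H -> S_permutable G K -> S_permutable G H.

(* Main.v *)
Require Import Defs.
From mathcomp Require Import all_boot all_fingroup all_solvable.
From mathcomp Require Import ssralg.

(** The three conditions are all equivalent to a local one, called (Y): whenever
    [K] is a [p]-subgroup of [G], the [p']-elements of [N_G(K)] normalize every
    subgroup of [K]. It is reached from, and leads back to, the stated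
    conditions through a description of the structure of [G], called (S): for
    every prime [p], either [G] is [p]-nilpotent or every [p]-subgroup of [G] is
    normal in [G].

    [cond1] implies (Y) ([SS_permutable_norm_p'elt]). Let [H <= K] with [K] a
    normal [p]-subgroup of [N]. A supplement of [H] in [N] has [p]-power index,
    so up to conjugation by elements of [H] its Sylow [q]-subgroups, for [q]
    other than [p], are those of [N]; if [HQ] is a group then [H = HQ :&: K] is
    normal in it.

    (Y) implies solvability. For the smallest prime divisor [p] of [|G|], the
    [p']-elements of [N_G(K)] centralize [K], because a cyclic [p]-group has no
    automorphism of order a prime larger than [p]. Then [G] is [p]-nilpotent by
    a theorem of Frobenius ([Frobenius_p_nilpotent]): two Sylow [p]-subgroups
    [S], [T] are conjugate under the centralizer of [S :&: T], so a Sylow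
    subgroup [P] controls fusion and the transfer of [G] into [P / P^`(1)] is
    not trivial. Induction applies to the normal [p]-complement.

    From sections to (S). Both (Y) (by a Frattini argument) and the PST property
    imply the condition (Z): if [M <= K] are normal in [G] and [K / M] is a
    [p]-group, the [p']-elements of [G] normalize every subgroup between [M] and
    [K]. Condition (Z) passes to quotients, and for solvable [G] it implies (S)
    ([solvable_psections_structure]). Suppose that [G] is not [p]-nilpotent. If
    ['O_p^'(G) = 1] and [F = 'O_p(G)], then [p']-elements act on [F / 'Phi(F)]
    as scalars, hence are central modulo [F]; this makes [F] a Sylow subgroup,
    with [F = [~: F, G]] and all its subgroups normal. In general, divide by a
    minimal normal subgroup [V] inside ['O_p^'(G)]: a Sylow subgroup [P] acts on
    [V] as scalars, so [[~: P, G]], and with it [P], centralizes [V], whence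
    normality lifts from [G / V] to [G].

    From (S) back. (S) implies (Y) because in a [p]-nilpotent group [[~: K, x]
    <= K :&: 'O_p^'(G) = 1]; and (Y) gives [cond2] with [N_G(K)] itself as
    supplement. (S) implies PST because, under (S), [H] is S-permutable in [G]
    exactly when [H :&: S] is a Sylow subgroup of [H] for every Sylow subgroup
    [S] of [G], and this last property is plainly transitive. *)

Set Implicit Arguments.
Unset Strict Implicit.
Unset Printing Implicit Defensive.

Local Open Scope group_scope.

(** * Conditions equivalent to being a solvable PST-group *)

(** Condition (Y): the p'-elements of the normalizer of a p-subgroup K normalize
    all subgroups of K. For a non-prime p the only p-group is the trivial one,
    so primality need not be assumed. *)
Definition p'elts_normalize_psubgroups (gT : finGroupType) (G : {group gT}) :=
  forall (p : nat) (H K : {group gT}) (x : gT),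
    p.-group K -> H \subset K -> K \subset G ->
    x \in 'N_G(K) -> p^'.-elt x -> x \in 'N(H).

(** Condition (Z): the p'-elements of G normalize all subgroups lying between
    the two terms of a normal p-section K / M of G. Phrasing this with sections,
    rather than with normal p-subgroups, makes it inherited by quotients. *)
Definition p'elts_normalize_psections (gT : finGroupType) (G : {group gT}) :=
  forall (p : nat) (M H K : {group gT}) (x : gT),
    M <| G -> K <| G -> M \subset H -> H \subset K -> p.-group (K / M) ->
    x \in G -> p^'.-elt x -> x \in 'N(H).

(** Condition (S): for each prime p, either G is p-nilpotent, that is, G modulo
    its largest normal p'-subgroup is a p-group, or all p-subgroups of G are
    normal in G. *)
Definition p_nilpotent_or_psubgroups_normal
    (gT : finGroupType) (G : {group gT}) :=
  forall p : nat, prime p ->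
    p.-group (G / 'O_p^'(G)) \/
    forall H : {group gT}, p.-group H -> H \subset G -> H <| G.

(** H meets every Sylow subgroup of G in a Sylow subgroup of H. *)
Definition meets_Sylows_in_Sylows (gT : finGroupType) (G H : {group gT}) :=
  forall (p : nat) (S : {group gT}), p.-Sylow(G) S -> p.-Sylow(H) (H :&: S).

(** * Sylow subgroups and permutability *)

Section Permutability.

Variable gT : finGroupType.
Implicit Types (p q : nat) (G H K M N P Q S : {group gT}).

Lemma pgroup_p'group p q (rT : finGroupType) (A : {set rT}) :
  q != p -> q.-group A -> p^'.-group A.
Proof. by move=> nqp qA; apply: pi_p'group qA _; rewrite !inE eq_sym. Qed.

Lemma pgroup_p'elt p q Q x :
  q != p -> q.-group Q -> x \in Q -> p^'.-elt x.
Proof. by move=> nqp qQ; apply: mem_p_elt (pgroup_p'group nqp qQ). Qed.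

Lemma eq_of_Sylow_sub G H : H \subset G ->
    (forall p, prime p ->
      exists2 P : {group gT}, p.-Sylow(G) P & P \subset H) ->
  H :=: G.
Proof.
move=> sHG sylH; apply/eqP; rewrite eqEcard sHG dvdn_leq //.
apply/dvdn_partP=> // p; rewrite mem_primes => /and3P[p_pr _ _].
by have [P sylP sPH] := sylH p p_pr; rewrite -(card_Hall sylP) cardSg.
Qed.

(** A p'-element is a product of q-elements, for primes q other than p. *)
Lemma p'elt_mem G H p x :
    (forall q Q, prime q -> q != p -> q.-Sylow(G) Q -> Q \subset H) ->
  x \in G -> p^'.-elt x -> x \in H.
Proof.
move=> sylH Gx p'x; rewrite -(prod_constt x).
rewrite big_nat_cond; apply: group_prod => q _.
have [->|nqp] := eqVneq q p.
  by rewrite (_ : x.`_p = 1) //; apply/constt1P.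
have [q_pr|/negbTE q'] := boolP (prime q); last first.
  suff /eqP->: x.`_q == 1 by [].
  by rewrite -order_eq1 order_constt p_part lognE q'.
have xqG: <[x.`_q]> \subset G.
  by rewrite (subset_trans _ (_ : <[x]> \subset G)) // cycle_subG ?cycle_constt.
have [Q sylQ sxQ] := Sylow_superset xqG (p_elt_constt q x).
by rewrite -cycle_subG (subset_trans sxQ) ?(sylH q).
Qed.

Lemma permute_sub H P : H \subset P -> permute H P.
Proof. by move=> sHP; rewrite /permute /commute mulSGid ?mulGSid. Qed.

Lemma permute_norm H P : P \subset 'N(H) -> permute H P.
Proof. by move/normC/esym. Qed.

(** If H permutes with Q and Q normalizes a group K containing H and meeting Q
    inside H, then H = HQ :&: K by the modular law, so Q normalizes H. *)
Lemma permute_TI_norm H K Q :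
    permute H Q -> H \subset K -> Q \subset 'N(K) -> Q :&: K \subset H ->
  Q \subset 'N(H).
Proof.
move=> HQ sHK nKQ sQKH; have defHQ: H <*> Q = H * Q by rewrite comm_joingE.
have <-: (H <*> Q) :&: K = H by rewrite defHQ -group_modl // mulGSid.
rewrite (subset_trans (joing_subr H Q)) // normsI ?normG //.
by rewrite join_subG nKQ (subset_trans sHK) ?normG.
Qed.

Lemma q_setI_psection K M Q p q :
    q != p -> q.-group Q -> M <| K -> p.-group (K / M) ->
  Q :&: K \subset M.
Proof.
move=> nqp qQ /andP[sMK nMK] pKM.
have nMQK: Q :&: K \subset 'N(M) by rewrite (subset_trans (subsetIr _ _)).
rewrite -quotient_sub1 //; apply/trivgP/eqP; rewrite trivg_card1.
have qQK: q.-group ((Q :&: K) / M).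
  by rewrite quotient_pgroup ?(pgroupS _ qQ) ?subsetIl.
have pQK: p.-group ((Q :&: K) / M).
  by rewrite (pgroupS _ pKM) ?quotientS ?subsetIr.
by apply/eqP/(pnat_1 pQK)/(pgroup_p'group nqp qQK).
Qed.

(** For a subgroup H of a normal p-subgroup, SS-permutability in G already
    forces every p'-element of G to normalize H. *)
Lemma SS_permutable_norm_p'elt G H K p :
    p.-group K -> H \subset K -> K <| G -> SS_permutable G H ->
  forall x, x \in G -> p^'.-elt x -> x \in 'N(H).
Proof.
move=> pK sHK /andP[sKG nKG] [sHG [B [[sBG defG] permB]]] x Gx p'x.
have pH := pgroupS sHK pK.
apply: (@p'elt_mem G 'N(H)%G p x) Gx p'x => q Q q_pr nqp sylQ /=.
have sQG := pHall_sub sylQ.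
have [T sylT] := Sylow_exists q B.
have q'H: q^'.-group H by apply: pgroup_p'group pH; rewrite eq_sym.
(* |G : B| is a power of p, so Sylow q-subgroups of B are Sylow in G. *)
have sylTG: q.-Sylow(G) T.
  rewrite pHallE (subset_trans (pHall_sub sylT) sBG) (card_Hall sylT) /=.
  have /(congr1 (partn^~ q)) := mul_cardG H B.
  rewrite defG !partnM ?cardG_gt0 // (part_p'nat q'H) mul1n => ->.
  by rewrite (part_p'nat (pgroupS (subsetIl H B) q'H)) muln1.
have [g Gg defQ] := Sylow_trans sylTG sylQ.
(* As G = HB, a conjugate of Q by an element of H is a Sylow subgroup of B. *)
move: Gg; rewrite -groupV -defG => /mulsgP[h b Hh Bb defg].
have defQh: Q :^ h = T :^ b^-1.
  rewrite defQ -conjsgM; congr (_ :^ _).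
  by rewrite -(invgK g) defg invMg mulgKV.
have sylTb: Sylow B (T :^ b^-1) by rewrite SylowJ ?groupV // (p_Sylow sylT).
have HQh := permB [group of T :^ b^-1] sylTb.
suff: Q :^ h \subset 'N(H).
  by rewrite -{1}(conjGid Hh) normJ conjSg.
rewrite defQh; apply: (permute_TI_norm HQh sHK).
  rewrite /= -defQh; apply: subset_trans nKG.
  by rewrite conj_subG // (subsetP sHG).
rewrite /= -defQh coprime_TIg ?sub1G // cardJg.
apply: pnat_coprime (pHall_pgroup sylQ) _.
by apply: pgroup_p'group pK; rewrite eq_sym.
Qed.

Lemma S_permutable_section_norm G H K M p q Q :
    S_permutable G H -> M <| G -> K <| G -> M \subset H -> H \subset K ->
    p.-group (K / M) -> q != p -> q.-Sylow(G) Q ->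
  Q \subset 'N(H).
Proof.
move=> [sHG permH] nsMG /andP[sKG nKG] sMH sHK pKM nqp sylQ.
have sQG := pHall_sub sylQ.
apply: permute_TI_norm (sHK) _ _.
- exact: permH (p_Sylow sylQ).
- exact: subset_trans sQG nKG.
apply: subset_trans (sMH).
apply: q_setI_psection nqp (pHall_pgroup sylQ) _ pKM.
exact: normalS (subset_trans sMH sHK) sKG nsMG.
Qed.

Lemma S_permutable_normal G H : H <| G -> S_permutable G H.
Proof.
case/andP=> sHG nHG; split=> // P /SylowP[p _ sylP].
exact/permute_norm/(subset_trans (pHall_sub sylP)).
Qed.

(** A subgroup H between the terms of a normal p-section K / M is subnormal in
    G. The S-permutability of H descends from K along iterated normalizers in K,
    which grow strictly because K / M is nilpotent. *)
Lemma PST_S_permutable_section G M H K p :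
    PST_group G -> M <| G -> K <| G -> M \subset H -> H \subset K ->
  p.-group (K / M) -> S_permutable G H.
Proof.
move=> pstG nsMG nsKG sMH sHK pKM.
have [n] := ubnP (#|K| - #|H|); elim: n H sMH sHK => // n IHn H sMH sHK lt_n.
have [->|neHK] := eqVneq H K; first exact: S_permutable_normal.
have [sKG _] := andP nsKG; have sHG := subset_trans sHK sKG.
have prHN: H \proper 'N_K(H).
  have nsMH := normalS sMH sHG nsMG.
  have nsMK := normalS (subset_trans sMH sHK) sKG nsMG.
  have nsMN: M <| 'N_K(H)%G.
    apply: normalS nsMK; rewrite ?subsetIl // (subset_trans sMH) //.
    by rewrite subsetI sHK normG.
  rewrite -(quotient_proper nsMH nsMN) /= quotient_subnormG //.
  rewrite nilpotent_proper_norm ?(pgroup_nil pKM) //.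
  by rewrite quotient_proper // properEneq neHK.
apply: (pstG H 'N_K(H)%G) => /=.
- exact: proper_sub.
- by rewrite subIset ?sKG.
- by apply: S_permutable_normal; rewrite /normal proper_sub ?subsetIr.
apply: IHn; rewrite ?subsetIl ?(subset_trans sMH) ?proper_sub //.
rewrite -ltnS (leq_trans _ lt_n) // ltnS ltn_sub2l ?proper_card //.
by rewrite properEneq neHK.
Qed.

Lemma PST_p'elts_normalize_psections G :
  PST_group G -> p'elts_normalize_psections G.
Proof.
move=> pstG p M H K x nsMG nsKG sMH sHK pKM Gx p'x.
have SpermH := PST_S_permutable_section pstG nsMG nsKG sMH sHK pKM.
apply: (@p'elt_mem G 'N(H)%G p x) Gx p'x => q Q q_pr nqp sylQ /=.
exact: S_permutable_section_norm SpermH nsMG nsKG sMH sHK pKM nqp sylQ.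
Qed.

End Permutability.

(** * Transitivity of S-permutability under the structural condition *)

Section Transitivity.

Variable gT : finGroupType.
Implicit Types (p q : nat) (G H K N P Q S : {group gT}).

(** S is a Sylow subgroup of the group HS, so |H : H :&: S| = |HS : S| is prime
    to p. *)
Lemma S_permutable_meets_Sylows G H :
  S_permutable G H -> meets_Sylows_in_Sylows G H.
Proof.
move=> [sHG permH] p S sylS.
have HS : permute H S by apply: permH (p_Sylow sylS).
have pS := pHall_pgroup sylS.
have sylHS: p.-Sylow(H <*> S) S.
  apply: pHall_subl (sylS); first exact: joing_subr.
  by rewrite join_subG sHG (pHall_sub sylS).
rewrite pHallE subsetIl -(eqn_pmul2l (cardG_gt0 S)) /=.
have /(congr1 (partn^~ p)) := mul_cardG H S.
rewrite -comm_joingE // !partnM ?cardG_gt0 // -(card_Hall sylHS).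
rewrite (part_pnat_id pS) (part_pnat_id (pgroupS (subsetIr H S) pS)) => <-.
by rewrite mulnC.
Qed.

Lemma meets_Sylows_trans G H K : H \subset K ->
    meets_Sylows_in_Sylows K H -> meets_Sylows_in_Sylows G K ->
  meets_Sylows_in_Sylows G H.
Proof.
move=> sHK mHK mKG p S sylS.
by have := mHK _ _ (mKG _ _ sylS); rewrite /= setIA (setIidPl sHK).
Qed.

Lemma p_nilpotent_Hall G p :
  p.-group (G / 'O_p^'(G)) -> p^'.-Hall(G) 'O_p^'(G).
Proof.
move=> pGN; rewrite /pHall pcore_sub pcore_pgroup pnatNK.
by rewrite -card_quotient ?normal_norm ?pcore_normal.
Qed.

(** A Frattini argument in the normal p-complement, which contains Q. *)
Lemma p_nilpotent_norm_Sylow G Q p q :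
    q != p -> p.-group (G / 'O_p^'(G)) -> q.-Sylow(G) Q ->
  exists2 S : {group gT}, p.-Sylow(G) S & S \subset 'N(Q).
Proof.
move=> nqp pGN sylQ; set N := 'O_p^'(G)%G.
have nsNG: N <| G := pcore_normal _ _.
have sQN: Q \subset N.
  rewrite (sub_normal_Hall (p_nilpotent_Hall pGN)) ?(pHall_sub sylQ) //.
  exact: pgroup_p'group nqp (pHall_pgroup sylQ).
have sylQN: q.-Sylow(N) Q := pHall_subl sQN (pcore_sub _ _) sylQ.
have defG := Frattini_arg nsNG sylQN.
have [S sylS] := Sylow_exists p 'N_G(Q).
exists S; last by rewrite (subset_trans (pHall_sub sylS)) ?subsetIr.
rewrite pHallE (subset_trans (pHall_sub sylS)) ?subsetIl // (card_Hall sylS).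
have /(congr1 (partn^~ p)) := mul_cardG N 'N_G(Q).
rewrite /= defG !partnM ?cardG_gt0 // (part_p'nat (pcore_pgroup _ _)).
rewrite mul1n => ->.
by rewrite (part_p'nat (pgroupS (subsetIl _ _) (pcore_pgroup _ _))) muln1.
Qed.

(** Given a Sylow q-subgroup Q of G, H is the product of its G-core and of its
    subgroup 'N_H(Q), and Q permutes with both. *)
Lemma meets_Sylows_S_permutable G H :
    p_nilpotent_or_psubgroups_normal G -> H \subset G ->
    meets_Sylows_in_Sylows G H -> S_permutable G H.
Proof.
move=> stG sHG mHG; split=> // Q /SylowP[q q_pr sylQ].
pose A := gcore H G; have [sAH nAG]: A \subset H /\ G \subset 'N(A).
  by rewrite gcore_sub gcore_norm.
have sNH: 'N_H(Q) \subset H by rewrite subsetIl.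
have nAN : 'N_H(Q) \subset 'N(A) by rewrite subIset // (subset_trans sHG).
have defAN: A <*> 'N_H(Q) = A * 'N_H(Q) by rewrite norm_joinEr.
have defH: A * 'N_H(Q) = H.
  (* A * 'N_H(Q) contains a Sylow r-subgroup of H for each prime r: H :&: Q if
     r = q, one inside A if the r-subgroups of G are normal, and otherwise the
     trace on H of a Sylow r-subgroup of G that normalizes Q. *)
  rewrite -defAN; apply: eq_of_Sylow_sub => [|r r_pr].
    by rewrite join_subG sAH.
  have [->|] := eqVneq r q; last rewrite eq_sym => nrq.
    exists (H :&: Q)%G; first exact: mHG.
    by rewrite (subset_trans _ (joing_subr _ _)) //= setIS ?normG.
  have [rnilG|nrG] := stG r r_pr; last first.
    have [R sylR] := Sylow_exists r H; exists R => //.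
    rewrite (subset_trans _ (joing_subl _ _)) //.
    have sRG := subset_trans (pHall_sub sylR) sHG.
    have /andP[_ nRG] := nrG R (pHall_pgroup sylR) sRG.
    by rewrite gcore_max ?(pHall_sub sylR).
  have [S sylS nQS] := p_nilpotent_norm_Sylow nrq rnilG sylQ.
  exists (H :&: S)%G; first exact: mHG.
  by rewrite (subset_trans _ (joing_subr _ _)) //= setIS.
suff: A * 'N_H(Q) * Q = Q * (A * 'N_H(Q)) by rewrite defH.
rewrite -mulgA (normC (subsetIr H _)) !mulgA.
by rewrite (normC (subset_trans (pHall_sub sylQ) nAG)).
Qed.

Lemma p_nilpotent_or_normal_PST G :
  p_nilpotent_or_psubgroups_normal G -> PST_group G.
Proof.
move=> stG H K sHK sKG /S_permutable_meets_Sylows mHK.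
move=> /S_permutable_meets_Sylows mKG.
apply: meets_Sylows_S_permutable (meets_Sylows_trans sHK mHK mKG) => //.
exact: subset_trans sKG.
Qed.

Lemma p_nilpotent_or_normal_p'elts G :
  p_nilpotent_or_psubgroups_normal G -> p'elts_normalize_psubgroups G.
Proof.
move=> stG p H K x pK sHK sKG /setIP[Gx nKx] p'x.
have [p_pr|p'] := boolP (prime p); last first.
  have K1: K :=: 1.
    have [//|[r r_pr rK]] := trivgVpdiv K.
    by move/pgroupP: pK => /(_ r r_pr rK) /eqP defr; rewrite -defr r_pr in p'.
  suff ->: H :=: 1 by rewrite norm1 inE.
  by apply/trivgP; rewrite -K1.
have [pnilG|nG] := stG p p_pr; last first.
  have [_ /subsetP-> //] := andP (nG H (pgroupS sHK pK) (subset_trans sHK sKG)).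
have Nx: x \in 'O_p^'(G).
  by rewrite (mem_normal_Hall (p_nilpotent_Hall pnilG)) ?pcore_normal.
suff cKx: x \in 'C(K).
  by rewrite (subsetP (cent_sub H)) // (subsetP (centS sHK)).
apply/centP => y Ky; apply/commgP/eqP/set1gP.
have nNG := normal_norm (pcore_normal p^' G).
have <-: 'O_p^'(G) :&: K = 1.
  rewrite coprime_TIg // coprime_sym.
  exact: pnat_coprime pK (pcore_pgroup _ _).
apply/setIP; split.
  rewrite commgEl groupM ?groupV // memJ_norm //.
  by rewrite (subsetP nNG) ?(subsetP sKG).
by rewrite commgEr groupM // memJ_norm ?groupV.
Qed.

End Transitivity.

(** * A p-nilpotence criterion of Frobenius *)

(** The p'-elements of the normalizer of any p-subgroup K of G centralize K;
    equivalently, each 'N_G(K) / 'C_G(K) is a p-group. *)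
Definition p'elts_centralize_psubgroups
    (gT : finGroupType) (p : nat) (G : {group gT}) :=
  forall (K : {group gT}) (x : gT), p.-group K -> K \subset G ->
    x \in 'N_G(K) -> p^'.-elt x -> x \in 'C(K).

Section Frobenius.

Variables (gT : finGroupType) (p : nat).
Implicit Types A B D G H K M N P Q R S T U W : {group gT}.

Lemma norm_eq_cent_mul_Sylow G D A :
    p'elts_centralize_psubgroups p G -> p.-group D -> D \subset G ->
    p.-Sylow('N_G(D)) A -> 'C_G(D) * A = 'N_G(D).
Proof.
move=> cG pD sDG sylA.
have nCN : 'N_G(D) \subset 'N('C_G(D)).
  by rewrite normsI ?norms_cent ?subsetIr // subIset ?normG.
have sAN := pHall_sub sylA.
have <-: 'C_G(D) <*> A = 'C_G(D) * A.
  by rewrite norm_joinEr // (subset_trans sAN).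
apply: eq_of_Sylow_sub => [|q q_pr].
  by rewrite join_subG sAN setIS ?cent_sub.
have [->|nqp] := eqVneq q p; first by exists A => //; exact: joing_subr.
have [Q sylQ] := Sylow_exists q 'N_G(D); exists Q => //.
rewrite (subset_trans _ (joing_subl _ _)) //.
apply/subsetP => x Qx; have Nx := subsetP (pHall_sub sylQ) x Qx.
rewrite inE (subsetP (subsetIl G 'N(D))) //=; apply: cG Nx _ => //.
exact: pgroup_p'elt nqp (pHall_pgroup sylQ) Qx.
Qed.

(** Downward induction on the order of D = S :&: T: when D is not S, S and T are
    linked through two Sylow subgroups, S1 and a conjugate of it by an element
    of 'C_G(D): the first meets S in a group containing 'N_S(D), the second
    meets T in a group containing 'N_T(D), and both normalizers exceed D. *)
Lemma Sylow_conj_cent_setI G S T :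
    p'elts_centralize_psubgroups p G -> p.-Sylow(G) S -> p.-Sylow(G) T ->
  exists2 c, c \in 'C_G(S :&: T) & T :=: S :^ c.
Proof.
move=> cG; have [n] := ubnP (#|G| - #|S :&: T|).
elim: n S T => // n IHn S T lt_n sylS sylT; pose D := (S :&: T)%G.
have [[sSG pS] [sTG pT]] :=
  ((pHall_sub sylS, pHall_pgroup sylS), (pHall_sub sylT, pHall_pgroup sylT)).
have sDS : D \subset S := subsetIl S T.
have sDT : D \subset T := subsetIr S T.
have sDG := subset_trans sDS sSG.
have [eqDS|neDS] := eqVneq (D : {set gT}) S.
  exists 1; rewrite ?group1 // conjsg1.
  apply/esym/eqP; rewrite eqEcard (card_Hall sylS) (card_Hall sylT) leqnn andbT.
  by rewrite -eqDS.
have neDT : D != T :> {set gT}.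
  apply: contra neDS => /eqP eqDT; rewrite eqEcard sDS eqDT.
  by rewrite (card_Hall sylS) (card_Hall sylT) leqnn.
have pD := pgroupS sDS pS.
have ltDN R :
    p.-group R -> D \subset R -> D != R :> {set gT} -> D \proper 'N_R(D).
  move=> pR sDR neDR; rewrite (nilpotent_proper_norm (pgroup_nil pR)) //.
  by rewrite properEneq neDR.
have ltDS := ltDN S pS sDS neDS; have ltDT := ltDN T pT sDT neDT.
have [A sylA sSA] :=
  Sylow_superset (setSI 'N(D) sSG) (pgroupS (subsetIl _ _) pS).
have [B sylB sTB] :=
  Sylow_superset (setSI 'N(D) sTG) (pgroupS (subsetIl _ _) pT).
have [g Ng defB] := Sylow_trans sylA sylB.
have nCA : commute 'C_G(D) A.
  apply/esym/normC; rewrite (subset_trans (pHall_sub sylA)) //.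
  by rewrite normsI ?norms_cent ?subsetIr // subIset ?normG.
move: Ng; rewrite /= -(norm_eq_cent_mul_Sylow cG pD sDG sylA) nCA.
case/mulsgP=> a c1 Aa Cc1 def_g.
have defB1: B :=: A :^ c1 by rewrite defB def_g conjsgM conjGid.
have sAG := subset_trans (pHall_sub sylA) (subsetIl G _).
have [S1 sylS1 sAS1] := Sylow_superset sAG (pHall_pgroup sylA).
have Gc1: c1 \in G by case/setIP: Cc1.
have sylS1c: p.-Sylow(G) (S1 :^ c1) by rewrite pHallJ.
have sDS1 : D \proper S :&: S1.
  apply: (proper_sub_trans ltDS).
  by rewrite subsetI subsetIl (subset_trans sSA).
have sDS2 : D \proper (S1 :^ c1) :&: T.
  apply: (proper_sub_trans ltDT).
  by rewrite subsetI subsetIl (subset_trans sTB) // defB1 conjSg.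
have IH U W : p.-Sylow(G) U -> p.-Sylow(G) W -> D \proper U :&: W ->
    exists2 c, c \in 'C_G(D) & W :=: U :^ c.
  move=> sylU sylW prD.
  have [|c Cc ->] := IHn U W _ sylU sylW; last first.
    by exists c; rewrite // (subsetP (setIS G (centS (proper_sub prD)))).
  have ltD: #|S :&: T| < #|U :&: W| := proper_card prD.
  have leG: #|U :&: W| <= #|G|.
    by rewrite subset_leq_card // subIset // (pHall_sub sylU).
  by rewrite -ltnS (leq_trans _ lt_n) // ltnS ltn_sub2l // (leq_trans ltD).
have [c2 Cc2 defS1] := IH S S1 sylS sylS1 sDS1.
have [c3 Cc3 defT] := IH _ _ sylS1c sylT sDS2.
exists (c2 * c1 * c3); first by rewrite !groupM.
by rewrite defT /= defS1 !conjsgM.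
Qed.

Lemma Sylow_control_fusion G P x g :
    p'elts_centralize_psubgroups p G -> p.-Sylow(G) P ->
    x \in P -> g \in G -> x ^ g \in P ->
  exists2 u, u \in P & x ^ g = x ^ u.
Proof.
move=> cG sylP Px Gg Pxg; have sPG := pHall_sub sylP.
have sylPg: p.-Sylow(G) (P :^ g^-1) by rewrite pHallJ ?groupV.
have [c /setIP[Gc cPc] defPg] := Sylow_conj_cent_setI cG sylP sylPg.
have cxc: x ^ c = x.
  apply/conjg_fixP/commgP; apply: commute_sym; apply: (centP cPc).
  by rewrite inE Px mem_conjgV.
have Ncg : c * g \in 'N_G(P).
  by rewrite inE groupM //= inE conjsgM -defPg conjsgKV.
have sylPN: p.-Sylow('N_G(P)) P by rewrite Sylow_subnorm.
move: Ncg; rewrite -(norm_eq_cent_mul_Sylow cG (pHall_pgroup sylP) sPG sylPN).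
case/mulsgP=> d u /setIP[_ cPd] Pu def_cg; exists u => //.
rewrite -{1}cxc -conjgM def_cg conjgM; congr (_ ^ _).
by apply/conjg_fixP/commgP; apply: commute_sym; apply: (centP cPd).
Qed.

(** The kernel of the transfer from G to the abelianization of P. By control of
    fusion, every factor of the transfer of g \in P is the image of a power of
    g, so the transfer of g is the image of g ^+ #|G : P|; as #|G : P| is prime
    to p, this is trivial only if g lies in P^`(1). *)
Lemma exists_normal_pindex G P :
    p'elts_centralize_psubgroups p G -> p.-Sylow(G) P -> P :!=: 1 ->
  exists M : {group gT}, [/\ M <| G, M \proper G & p.-group (G / M)].
Proof.
move=> cG sylP ntP; have sPG := pHall_sub sylP; have pP := pHall_pgroup sylP.
have nP'P : P \subset 'N(P^`(1)) := der_norm 1 P.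
pose alpha := restrm_morphism nP'P (coset_morphism P^`(1)).
have im_alpha: alpha @* P = P / P^`(1) by rewrite morphim_restrm setIid.
have abA : abelian (alpha @* P) by rewrite im_alpha sub_der1_abelian.
have ab_alpha u v : u \in P -> v \in P -> alpha (u ^ v) = alpha u.
  move=> Pu Pv; rewrite morphJ //; apply/conjg_fixP/commgP.
  by apply: (centsP abA); rewrite mem_morphim.
pose V := transfer_morphism G abA.
exists ('ker V)%G; rewrite ker_normal; split=> //.
  have solP := pgroup_sol pP.
  have /properP[_ [g Pg P'g]] := sol_der1_proper solP (subxx P) ntP.
  have Gg := subsetP sPG g Pg.
  rewrite properEneq subsetIl andbT; apply: contraNneq P'g => defG.
  have: g \in 'ker V by rewrite defG.
  case/morphpreP=> _ /set1P /= Vg.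
  have partGg := rcosets_cycle_partition sPG Gg.
  have trX := transversalP partGg; set X := transversal _ _ in trX.
  pose n_ x := #|<[g]> : P :* x|.
  have PgX x : x \in X -> (g ^+ n_ x) ^ x^-1 \in P.
    move=> Xx; have Gx := subsetP (transversal_sub trX) x Xx.
    by rewrite conjgE invgK mulgA -mem_rcoset mulg_exp_card_rcosets.
  have alX x : x \in X -> alpha ((g ^+ n_ x) ^ x^-1) = alpha g ^+ n_ x.
    move=> Xx; have Gx := subsetP (transversal_sub trX) x Xx.
    have [u Pu ->] :=
      Sylow_control_fusion cG sylP (groupX _ Pg) (groupVr Gx) (PgX x Xx).
    by rewrite ab_alpha ?groupX // morphX.
  have ag : alpha g \in alpha @* P by rewrite mem_morphim.
  have := transfer_cycle_expansion sPG abA Gg trX.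
  rewrite Vg (eq_bigr (fun x => FiniteModule.fmod abA (alpha g) *+ n_ x)%R).
    rewrite GRing.Theory.sumrMnr (sum_index_rcosets_cycle sPG Gg trX).
    move/(congr1 (@FiniteModule.fmval _ _ abA)); rewrite FiniteModule.fmvalZ.
    rewrite FiniteModule.fmodK // => ag1.
    apply: coset_idr; first exact: (subsetP nP'P).
    have pa : p.-elt (alpha g) by rewrite morph_p_elt // (mem_p_elt pP).
    have [_ _ p'GP] := and3P sylP.
    have /eqP : #[alpha g] = 1%N.
      by apply: pnat_1 pa (pnat_dvd _ p'GP); rewrite order_dvdn; apply/eqP.
    by rewrite order_eq1 => /eqP.
  move=> x Xx /=; rewrite -FiniteModule.fmodX //; congr FiniteModule.fmod.
  exact: alX.
rewrite (isog_pgroup p (first_isog V)).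
have inj_val: 'injm (FiniteModule.fmval_morphism abA).
  by apply/injmP=> u v _ _; apply: FiniteModule.fmod_inj.
rewrite -(injm_pgroup inj_val) ?subsetT //.
apply: (@pgroupS _ p (alpha @* P)%G); last by rewrite morphim_pgroup.
by apply/subsetP=> _ /morphimP[u _ _ ->]; apply: FiniteModule.fmodP.
Qed.

Lemma Frobenius_p_nilpotent G :
  p'elts_centralize_psubgroups p G -> p.-group (G / 'O_p^'(G)).
Proof.
have [n] := ubnP #|G|; elim: n G => // n IHn G leGn cG.
have [P sylP] := Sylow_exists p G.
have [P1|ntP] := eqVneq (P : {set gT}) 1.
  have p'G: p^'.-group G by rewrite -partG_eq1 -(card_Hall sylP) P1 cards1.
  by rewrite (pcore_pgroup_id p'G) trivg_quotient pgroup1.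
have [M [nsMG prMG pGM]] := exists_normal_pindex cG sylP ntP.
have sMG := proper_sub prMG.
have pMN: p.-group (M / 'O_p^'(M)).
  apply: IHn; first exact: leq_trans (proper_card prMG) leGn.
  move=> K x pK sKM /setIP[Mx nKx]; apply: cG => //.
    exact: subset_trans sMG.
  by rewrite inE (subsetP sMG).
have hallM := p_nilpotent_Hall pMN.
have nsNG : 'O_p^'(M) <| G by apply: gFnormal_trans.
suff hallG: p^'.-Hall(G) 'O_p^'(M).
  rewrite /= (normal_Hall_pcore hallG nsNG).
  by rewrite /pgroup card_quotient ?normal_norm // -pnatNK; case/and3P: hallG.
rewrite /pHall normal_sub // pcore_pgroup /= pnatNK.
rewrite -(Lagrange_index sMG) ?pcore_sub //.
have piM: p.-nat #|G : M| by rewrite -card_quotient ?normal_norm.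
rewrite pnatM piM /=.
by case/and3P: hallM => _ _; rewrite pnatNK.
Qed.

End Frobenius.

(** * Consequences of the local condition *)

Section LocalCondition.

Variable gT : finGroupType.
Implicit Types (p q : nat) (G H K M N P Q S : {group gT}).

Lemma coprime_norm_cycle_cent (x y : gT) :
  x \in 'N(<[y]>) -> coprime #[x] (totient #[y]) -> x \in 'C(<[y]>).
Proof.
move=> nyx co_xy; rewrite -ker_conj_aut -sub1set.
have Nx: x \in 'dom (conj_aut <[y]>) by [].
apply/subsetP => _ /set1P->; apply/kerP => //; apply/eqP.
rewrite -order_eq1 -dvdn1 -(eqP co_xy) dvdn_gcd morph_order //=.
by rewrite -card_Aut_cycle order_dvdG // Aut_aut.
Qed.

(** For k <> 1 in a p-group, the order of the automorphism group of <[k]> is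
    p - 1 times a power of p.  It is prime to the order of any p'-element of G
    when p is the smallest prime divisor of #|G|. *)
Lemma p'elts_centralize_pdiv G : G :!=: 1 ->
  p'elts_normalize_psubgroups G -> p'elts_centralize_psubgroups (pdiv #|G|) G.
Proof.
rewrite -cardG_gt1 => /pdiv_prime; set p := pdiv _ => p_pr yG K x pK sKG Nx p'x.
apply/centP => k Kk.
have sxG: #[x] %| #|G| by rewrite order_dvdG //; case/setIP: Nx.
have nkx: x \in 'N(<[k]>) by apply: yG Nx p'x; rewrite ?cycle_subG.
apply: (centP (coprime_norm_cycle_cent nkx _)); last exact: cycle_id.
rewrite coprime_has_primes ?totient_gt0 ?order_gt0 //; apply/hasPn => r.
rewrite !mem_primes => /and3P[r_pr _]; apply: contraL => /and3P[_ _ rx].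
have nrp: r != p.
  by have /pnatP := p'x => /(_ (order_gt0 x) r r_pr rx); rewrite !inE.
have lepr: p <= r by rewrite pdiv_min_dvd ?prime_gt1 // (dvdn_trans rx).
have /p_natP[[|n] ->] : p.-nat #[k] by exact: mem_p_elt pK Kk.
  by rewrite expn0 dvdn1; case: eqP r_pr => // ->.
rewrite totient_pfactor // Euclid_dvdM // negb_or.
rewrite gtnNdvd /=.
- by rewrite Euclid_dvdX // negb_and (dvdn_prime2 r_pr p_pr) nrp.
- by rewrite -ltnS prednK ?prime_gt1 ?prime_gt0.
by rewrite prednK ?prime_gt0.
Qed.

Lemma p'elts_normalize_psubgroupsS G H : H \subset G ->
  p'elts_normalize_psubgroups G -> p'elts_normalize_psubgroups H.
Proof.
move=> sHG yG p L K x pK sLK sKH /setIP[Hx nKx]; apply: yG pK sLK _ _.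
  exact: subset_trans sHG.
by rewrite inE (subsetP sHG).
Qed.

Lemma p'elts_normalize_psubgroups_sol G :
  p'elts_normalize_psubgroups G -> solvable G.
Proof.
have [n] := ubnP #|G|; elim: n G => // n IHn G leGn yG.
have [->|ntG] := eqVneq (G : {set gT}) 1; first exact: solvable1.
have p_pr: prime (pdiv #|G|) by rewrite pdiv_prime // cardG_gt1.
set p := pdiv #|G| in p_pr.
have pGN: p.-group (G / 'O_p^'(G)).
  exact/Frobenius_p_nilpotent/p'elts_centralize_pdiv.
rewrite (series_sol (pcore_normal p^' G)) (pgroup_sol pGN) andbT.
apply: IHn; last exact: p'elts_normalize_psubgroupsS (pcore_sub _ _) yG.
rewrite -ltnS (leq_trans _ leGn) // ltnS proper_card // properE pcore_sub.
apply: contraL (pdiv_dvd #|G|) => sGN.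
have /pgroupP/(_ p p_pr) := pgroupS sGN (pcore_pgroup _ _).
by move=> pG; apply/negP => /pG; rewrite !inE eqxx.
Qed.

(** If P is a Sylow p-subgroup of K, then K = M * P, and the Frattini argument
    writes a p'-element of G as an element of M times a p'-element of
    'N_G(P). *)
Lemma p'elts_normalize_psections_of_psubgroups G :
  p'elts_normalize_psubgroups G -> p'elts_normalize_psections G.
Proof.
move=> yG p M H K x nsMG nsKG sMH sHK pKM Gx p'x.
have [P sylP] := Sylow_exists p K.
have [[sMG nMG] [sKG nKG]] := (andP nsMG, andP nsKG).
have sPK := pHall_sub sylP; have sPG := subset_trans sPK sKG.
have nMP := subset_trans sPG nMG.
have defK: M * P = K.
  have sylPM : p.-Sylow(K / M) (P / M) by rewrite quotient_pHall.
  rewrite -quotientK // (pHall_id sylPM pKM) quotientGK //.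
  exact: normalS (subset_trans sMH sHK) sKG nsMG.
have defG: M * 'N_G(P) = G.
  have sPN: P \subset 'N_G(P) by rewrite subsetI sPG normG.
  by rewrite -(mulSGid sPN) mulgA defK (Frattini_arg nsKG sylP).
have: x \in M * 'N_G(P) by rewrite defG.
case/mulsgP=> m y Mm /setIP[Gy nPy] def_x.
have Nm: m \in 'N(M) by rewrite (subsetP (normG M)).
have Ny: y \in 'N(M) by rewrite (subsetP nMG).
have sNy pi : y.`_pi \in 'N_G(P).
  have sy: <[y]> \subset 'N_G(P) by rewrite cycle_subG inE Gy.
  by rewrite (subsetP sy) ?cycle_constt.
have [[Gyp _] [Gy' nPy']] := (setIP (sNy p), setIP (sNy p^')).
(* x and y agree modulo M, and x has no p-part. *)
have My: y.`_p \in M.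
  apply: coset_idr; first by rewrite (subsetP nMG).
  rewrite morph_constt //; apply/constt1P.
  have defy: coset M x = coset M y.
    by rewrite def_x morphM //= (coset_id Mm) mul1g.
  rewrite /= -defy.
  by rewrite morph_p_elt // (subsetP nMG).
rewrite def_x -(consttC p y) mulgA groupM //.
  by rewrite (subsetP (normG H)) // (subsetP sMH) ?groupM.
have defH: H :=: M * (P :&: H) by rewrite group_modl // defK (setIidPr sHK).
have nHPy: y.`_p^' \in 'N(P :&: H).
  apply: (yG p _ P) => //; first exact: pHall_pgroup sylP.
    exact: subsetIl.
  exact: p_elt_constt.
suff: y.`_p^' \in 'N(M * (P :&: H)) by rewrite -defH.
have nMy': y.`_p^' \in 'N(M) by rewrite (subsetP nMG).
by rewrite inE conjsMg (normP nMy') (normP nHPy).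
Qed.

Lemma pi_nontrivial_pgroup p K : p.-group K -> K :!=: 1 -> p \in \pi(K).
Proof.
move=> pK ntK; have [p_pr pdvK _] := pgroup_pdiv pK ntK.
by rewrite mem_primes p_pr cardG_gt0.
Qed.

Lemma SS_p'elts_normalize_psubgroups G :
    (forall p H K, p \in \pi(G) -> p.-group H -> p.-group K -> H \subset K ->
      K \subset G -> SS_permutable 'N_G(K)%G H) ->
  p'elts_normalize_psubgroups G.
Proof.
move=> ssG p H K x pK sHK sKG Nx p'x.
have [K1|ntK] := eqVneq (K : {set gT}) 1.
  by rewrite (_ : H :=: 1) ?norm1 ?inE //; apply/trivgP; rewrite -K1.
have piGp: p \in \pi(G).
  exact: (piSg sKG) (pi_nontrivial_pgroup pK ntK).
have ssH := ssG p H K piGp (pgroupS sHK pK) pK sHK sKG.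
apply: (SS_permutable_norm_p'elt pK sHK _ ssH) Nx p'x.
by rewrite normalSG.
Qed.

(** The group 'N_G(K) serves as its own normal supplement of H. *)
Lemma p'elts_NSS G p H K : p'elts_normalize_psubgroups G ->
    p.-group K -> H \subset K -> K \subset G ->
  NSS_permutable 'N_G(K)%G H.
Proof.
move=> yG pK sHK sKG.
have nsKN: K <| 'N_G(K) by rewrite normalSG.
have sHN: H \subset 'N_G(K) := subset_trans sHK (normal_sub nsKN).
split=> //; exists 'N_G(K)%G; split=> //; first by split=> //; exact: mulSGid.
move=> Q /SylowP[q q_pr sylQ].
have [eqp|nqp] := eqVneq q p.
  rewrite eqp in sylQ; apply/permute_sub/(subset_trans sHK).
  by rewrite (subset_trans (pcore_max pK nsKN)) // pcore_sub_Hall.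
apply: permute_norm; apply/subsetP=> x Qx.
apply: (yG p H K x) => //; first exact: (subsetP (pHall_sub sylQ)).
exact: pgroup_p'elt nqp (pHall_pgroup sylQ) Qx.
Qed.

End LocalCondition.

(** * Coprime action and the Fitting subgroup *)

Section CoprimeAndFitting.

Variable gT : finGroupType.
Implicit Types (p q : nat) (A E F G H K M N P Q S V W : {group gT}).

(** Let C = 'C_G('F(G)) and Z = C :&: 'F(G). If C were larger than Z, take W / Z
    minimal normal in G / Z inside C / Z: it is abelian, and Z is central in W,
    so W is nilpotent of class at most 2 and lies in 'F(G), a contradiction. *)
Lemma solvable_cent_Fitting G : solvable G -> 'C_G('F(G)) \subset 'F(G).
Proof.
move=> solG; set F := 'F(G); pose C := 'C_G(F)%G; pose Z := (C :&: F)%G.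
have nsFG: F <| G := Fitting_normal G.
have nsCG: C <| G.
  by rewrite /normal subsetIl normsI ?normG ?norms_cent ?normal_norm.
have nsZG: Z <| G by apply: normalI.
have sZC: Z \subset C := subsetIl _ _.
have [sCG nZG] := (normal_sub nsCG, normal_norm nsZG).
have nZC := subset_trans sCG nZG.
suff: C / Z == 1 by rewrite -subG1 quotient_sub1 // subsetI => /andP[].
apply/idPn=> ntCZ.
have [W1 minW1 sW1C] :=
  minnormal_exists ntCZ (quotient_norms Z (normal_norm nsCG)).
have sW1G := subset_trans sW1C (quotientS Z sCG).
have [nW1G ntW1 abW1] := minnormal_solvable minW1 sW1G (quotient_sol Z solG).
have nsW1G : W1 <| G / Z by rewrite /normal sW1G.
have [W defW sZW nsWG] := inv_quotientN nsZG nsW1G.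
have sWG := normal_sub nsWG; have nZW := subset_trans sWG nZG.
have sWC : W \subset C by move: sW1C; rewrite defW quotientSGK.
have derW : W^`(1) \subset Z.
  by rewrite der1_min // -defW; case/is_abelemP: abW1 => q _ /abelem_abelian.
have ZW : Z \subset 'Z(W).
  rewrite subsetI sZW (subset_trans (subsetIr _ _)) // centsC.
  by rewrite (subset_trans sWC) // subsetIr.
have nilW : nilpotent W.
  apply: small_nil_class; rewrite (leq_trans (_ : _ <= 2)) //.
  by rewrite nil_class2 (subset_trans derW).
have sWF : W \subset F by apply: Fitting_max.
by case/negP: ntW1; rewrite defW -subG1 quotient_sub1 // subsetI sWC.
Qed.

Lemma coprime_cent_quotient_Phi p F A :
    p.-group F -> p^'.-group A -> A \subset 'N(F) ->
    [~: F, A] \subset 'Phi(F) -> A \subset 'C(F).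
Proof.
move=> pF p'A nFA cFA.
have nPhi (X : {set gT}) : X \subset 'N(F) -> X \subset 'N('Phi(F)).
  exact: gFnorm_trans.
have coFA := pnat_coprime pF p'A.
have cQ: F / 'Phi(F) \subset 'C(A / 'Phi(F)).
  by rewrite quotient_cents2 ?nPhi ?normG.
have := coprime_quotient_cent (Phi_sub F) (nPhi A nFA) coFA (pgroup_sol pF).
rewrite (setIidPl cQ) => defQ.
have defF: 'Phi(F) <*> 'C_F(A) = F.
  have sCF : 'C_F(A) \subset F := subsetIl _ _.
  have nPhiC : 'C_F(A) \subset 'N('Phi(F)).
    by rewrite (subset_trans sCF) ?nPhi ?normG.
  by rewrite norm_joinEr // -quotientK // defQ quotientGK ?Phi_normal.
by rewrite centsC -{1}(Phi_nongen defF) genGid subsetIr.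
Qed.

(** An element normalizing every subgroup of an elementary abelian group acts on
    it as a scalar. *)
Lemma abelem_power_automorphism p E x : p.-abelem E ->
    (forall H, H \subset E -> x \in 'N(H)) ->
  exists n, {in E, forall u, u ^ x = u ^+ n}.
Proof.
move=> abE nEx.
have powx u : u \in E -> exists n, u ^ x = u ^+ n.
  move=> Eu; have : u ^ x \in <[u]>.
    by rewrite memJ_norm ?cycle_id // nEx // cycle_subG.
  by case/cycleP => n ->; exists n.
have [E1|ntE] := eqVneq (E : {set gT}) 1.
  by exists 0 => u; rewrite E1 => /set1P->; rewrite conj1g.
have p_pr : prime p by case: (pgroup_pdiv (abelem_pgroup abE) ntE).
have [u Eu ntu] := trivgPn _ ntE; have [n uxn] := powx u Eu.
exists n => v Ev.
have [|v'u] := boolP (v \in <[u]>).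
  by case/cycleP=> i ->; rewrite conjXg uxn -!expgM mulnC.
have ou := abelem_order_p abE Eu ntu.
have ntv : v != 1 by apply: contraNneq v'u => ->.
have ov := abelem_order_p abE Ev ntv.
have tiuv : <[u]> :&: <[v]> = 1.
  by rewrite setIC prime_TIg ?cycle_subG // -orderE ov.
have cuv : commute u v by apply: (centsP (abelem_abelian abE)).
have [[m vxm] [k uvk]] := (powx v Ev, powx (u * v) (groupM Eu Ev)).
(* Compare the actions on u, v and u * v, in the direct product of the cyclic
   groups generated by u and v. *)
have eq1 : u ^- k * u ^+ n = v ^+ k * v ^- m.
  have : u ^+ n * v ^+ m = u ^+ k * v ^+ k.
    by rewrite -uxn -vxm -conjMg uvk expgMn.
  by move/(canRL (mulgK _)) => ->; rewrite !mulgA mulVg mul1g.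
have un1 : u ^- k * u ^+ n = 1.
  apply/set1gP; rewrite -tiuv inE {2}eq1.
  by rewrite !groupM ?groupV ?groupX ?cycle_id.
have /eqP : u ^+ n = u ^+ k by apply/esym/eqP; rewrite eq_mulVg1 un1.
rewrite eq_expg_mod_order ou => /eqP nk.
move/eqP: eq1; rewrite un1 eq_sym -eq_mulgV1 => /eqP vk.
by rewrite vxm -vk; apply/eqP; rewrite eq_expg_mod_order ov nk.
Qed.

(** Scalars are central in the group of all automorphisms. *)
Lemma abelem_power_commg_cent p E x g : p.-abelem E ->
    (forall H, H \subset E -> x \in 'N(H)) -> g \in 'N(E) ->
  [~ x, g] \in 'C(E).
Proof.
move=> abE nEx nEg; have [n powx] := abelem_power_automorphism abE nEx.
apply/centP => u Eu; apply: commute_sym; apply/commgP/conjg_fixP.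
have nEx1 := nEx E (subxx _).
set w := u ^ x^-1.
have Ew: w \in E by rewrite memJ_norm ?groupV.
have Ewg: w ^ g^-1 \in E by rewrite memJ_norm ?groupV.
rewrite commgEl conjgM -/w -{1}(conjgKV g w) -conjJg (powx _ Ewg).
rewrite conjXg conjgKV.
by rewrite -powx // conjgKV.
Qed.

End CoprimeAndFitting.

(** * The structure of solvable groups satisfying the section condition *)

Section Structure.

Variable gT : finGroupType.
Implicit Types (p q : nat) (A E F G H K M N P Q S V W : {group gT}).

Lemma psections_norm_psubgroup p G F H x :
    p'elts_normalize_psections G -> F <| G -> p.-group F -> H \subset F ->
  x \in G -> p^'.-elt x -> x \in 'N(H).
Proof.
move=> secG nsFG pF sHF; apply: (secG p 1%G H F); rewrite ?normal1 ?sub1G //.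
exact: quotient_pgroup.
Qed.

(** Any p'-element acts on F / 'Phi(F), where F is the p-core, as a scalar.
    Hence commutators of p'-elements with elements of G centralize F / 'Phi(F),
    so they lie in F, and a Sylow p-subgroup S of G, which contains F, is
    normalized by all p'-elements and so equals F. As G is not a p-group, it has
    a p'-element x <> 1, which acts as a scalar other than 1 on F / 'Phi(F),
    whence F = [~: F, <[x]>]: this group is generated by products of two
    p'-elements, so it normalizes each subgroup of F. *)
Lemma pcore_structure p G : prime p -> solvable G ->
    p'elts_normalize_psections G -> 'O_p^'(G) = 1 -> ~~ p.-group G ->
  [/\ p.-Sylow(G) 'O_p(G), 'O_p(G) \subset [~: 'O_p(G), G] &
      forall H, H \subset 'O_p(G) -> H <| G].
Proof.
move=> p_pr solG secG Op'1 p'G; set F := 'O_p(G)%G.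
have pF: p.-group F := pcore_pgroup p G.
have nsFG: F <| G := pcore_normal p G.
have [sFG nFG] := andP nsFG.
have cFF: 'C_G(F) \subset F.
  by have := solvable_cent_Fitting solG; rewrite (Fitting_eq_pcore Op'1).
have nF H x := @psections_norm_psubgroup p G F H x secG nsFG pF.
have nPhiG: G \subset 'N('Phi(F)) by apply: gFnorm_trans.
have abE := Phi_quotient_abelem pF.
have nE x (H : {group coset_of 'Phi(F)}) : x \in G -> p^'.-elt x ->
    H \subset F / 'Phi(F) -> coset 'Phi(F) x \in 'N(H).
  move=> Gx p'x sHE; have [L -> _ sLF] := inv_quotientS (Phi_normal F) sHE.
  have Nx := subsetP nPhiG x Gx.
  by apply: (subsetP (quotient_norm _ _)); rewrite mem_quotient // nF.
have TI_F x : x \in F -> p^'.-elt x -> x = 1.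
  move=> Fx p'x; apply/eqP; rewrite -order_eq1; apply/eqP.
  exact: pnat_1 (mem_p_elt pF Fx) p'x.
(* D is the subgroup of G acting trivially on F / 'Phi(F).  Its p'-elements
   centralize F, hence lie in F, so that D is a normal p-subgroup. *)
pose D := (G :&: coset 'Phi(F) @*^-1 'C(F / 'Phi(F)))%G.
have Dp' x : x \in D -> p^'.-elt x -> x = 1.
  move=> /setIP[Gx /morphpreP[Nx cEx]] p'x.
  apply: TI_F (p'x); apply: (subsetP cFF); rewrite inE Gx /=.
  rewrite -cycle_subG; apply: (coprime_cent_quotient_Phi pF p'x).
    by rewrite cycle_subG (subsetP nFG).
  rewrite -quotient_cents2 ?cycle_subG ?(subset_trans sFG) //.
  by rewrite centsC quotient_cycle // cycle_subG.
have sDF : D \subset F.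
  apply: pcore_max.
    apply/pgroupP=> q q_pr /(Cauchy q_pr)[x Dx ox]; rewrite inE /=.
    apply: contraLR (prime_gt1 q_pr) => nqp.
    rewrite -ox (Dp' x) ?order1 // /p_elt ox pnatE //.
  rewrite /normal subsetIl normsI ?normG //.
  apply: (subset_trans (_ : G \subset coset 'Phi(F) @*^-1 (G / 'Phi(F)))).
    by rewrite -sub_quotient_pre.
  by rewrite morphpre_norms ?norms_cent ?quotient_norms.
have commD x g : x \in G -> p^'.-elt x -> g \in G -> [~ x, g] \in D.
  move=> Gx p'x Gg.
  have [Nx Ng] := (subsetP nPhiG x Gx, subsetP nPhiG g Gg).
  rewrite inE groupR //=; apply/morphpreP; split; first by rewrite groupR.
  rewrite morphR //=; apply: (abelem_power_commg_cent abE).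
    by move=> H sHE; apply: nE.
  by apply: (subsetP (quotient_norms _ nFG)); rewrite mem_quotient.
have sylF: p.-Sylow(G) F.
  have [S sylS] := Sylow_exists p G; have sSG := pHall_sub sylS.
  have sFS : F \subset S := pcore_sub_Hall sylS.
  suff defG: 'N_G(S) = G.
    have nsSG : S <| G by rewrite /normal sSG -{1}defG subsetIr.
    by rewrite /F /= (normal_Hall_pcore sylS nsSG).
  apply: eq_of_Sylow_sub => [|q q_pr]; first exact: subsetIl.
  have [->|nqp] := eqVneq q p.
    by exists S; rewrite // subsetI sSG normG.
  have [Q sylQ] := Sylow_exists q G; exists Q => //.
  rewrite subsetI (pHall_sub sylQ); apply/subsetP=> x Qx.
  have Gx := subsetP (pHall_sub sylQ) x Qx.
  have p'x := pgroup_p'elt nqp (pHall_pgroup sylQ) Qx.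
  rewrite inE; apply/subsetP=> _ /imsetP[s Ss ->].
  rewrite conjg_mulR groupM // -groupV invgR (subsetP sFS) ?(subsetP sDF) //.
  by rewrite commD // (subsetP sSG).
have [x Gx [p'x ntx]] : exists2 x, x \in G & p^'.-elt x /\ x != 1.
  have ltp' : 1 < (#|G|`_p^')%N.
    by rewrite ltn_neqAle eq_sym part_gt0 partG_eq1 pgroupNK p'G.
  have q_pr := pdiv_prime ltp'; set q := pdiv _ in q_pr.
  have qp' : q %| (#|G|`_p^')%N := pdiv_dvd _.
  have [x Gx ox] := Cauchy q_pr (dvdn_trans qp' (dvdn_part p^' _)).
  exists x => //; split; last by rewrite -order_eq1 ox neq_ltn prime_gt1 ?orbT.
  by rewrite /p_elt ox (pnat_dvd qp') ?part_pnat.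
have nPhiF := normal_norm (Phi_normal F).
have Nx := subsetP nPhiG x Gx.
have nFx : x \in 'N(F) by rewrite (subsetP nFG).
have defF: [~: F, <[x]>] = F.
  set R := [~: F, <[x]>]%G.
  have sRF : R \subset F by rewrite commg_subl cycle_subG.
  have [n powx] := abelem_power_automorphism abE
    (fun H : {group coset_of 'Phi(F)} => nE x H Gx p'x).
  have expE u : u \in F / 'Phi(F) -> u ^+ p = 1.
    by case/(abelemP p_pr): abE => _; apply.
  (* On F / 'Phi(F), commutation with x is raising to the power n - 1; adding p
     keeps this exponent a natural number when n = 0. *)
  have co_p : coprime p (n + p).-1.
    rewrite prime_coprime //; apply: contra ntx => p_n1.
    have n1 : n = 1 %[mod p].
      apply/eqP; rewrite -(modnDr n) eqn_mod_dvd ?subn1 //.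
      by rewrite addn_gt0 (prime_gt0 p_pr) orbT.
    apply/eqP/Dp' => //; rewrite inE Gx; apply/morphpreP; split=> //=.
    apply/centP => u Eu; apply/commute_sym/commgP/conjg_fixP.
    have expEu := expE u Eu.
    by rewrite (powx _ Eu) -(expg_mod _ expEu) n1 (expg_mod _ expEu).
  rewrite -[RHS](@Phi_nongen _ F R) ?genGid //; apply/eqP.
  rewrite eqEsubset join_subG Phi_sub sRF /=.
  rewrite norm_joinEr ?(subset_trans sRF) // -quotientSK //.
  apply/subsetP=> ubar Eu.
  have Ru : ubar ^+ (n + p).-1 \in R / 'Phi(F).
    have [u Nu Fu def_u] := morphimP Eu.
    have -> : ubar ^+ (n + p).-1 = coset 'Phi(F) [~ u, x].
      apply: (mulgI ubar); rewrite -expgS prednK; last first.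
        by rewrite addn_gt0 (prime_gt0 p_pr) orbT.
      rewrite expgD expE // mulg1 -powx // morphR //= -def_u.
      by rewrite commgEl mulKVg.
    by rewrite mem_quotient // mem_commg ?cycle_id.
  have coE: coprime #|F / 'Phi(F)| (n + p).-1.
    by rewrite (card_pgroup (abelem_pgroup abE)) coprimeXl.
  by rewrite -(expgK coE Eu) groupX.
have sFN H : H \subset F -> F \subset 'N(H).
  move=> sHF; rewrite -{1}defF gen_subG.
  apply/subsetP=> _ /imset2P[f y Ff xy ->].
  have Gf := subsetP sFG f Ff.
  have Gy : y \in G by rewrite (subsetP _ y xy) // cycle_subG.
  have p'y : p^'.-elt y := mem_p_elt p'x xy.
  by rewrite commgEr groupM ?nF // ?p_eltJ ?p_eltV ?groupJ ?groupV.
split=> //.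
  by rewrite -{1}defF commgS // cycle_subG.
move=> H sHF; have sHG := subset_trans sHF sFG.
rewrite /normal sHG; apply/setIidPl; apply: eq_of_Sylow_sub => [|q q_pr].
  exact: subsetIl.
have [->|nqp] := eqVneq q p; first by exists F; rewrite // subsetI sFG sFN.
have [Q sylQ] := Sylow_exists q G; exists Q => //.
rewrite subsetI (pHall_sub sylQ); apply/subsetP=> y Qy.
apply: nF => //; first exact: (subsetP (pHall_sub sylQ)).
exact: pgroup_p'elt nqp (pHall_pgroup sylQ) Qy.
Qed.

Lemma psections_quotient G V : V <| G ->
  p'elts_normalize_psections G -> p'elts_normalize_psections (G / V).
Proof.
move=> nsVG secG p M1 H1 K1 x1 nsM1 nsK1 sMH1 sHK1 pKM1 Gx1 p'x1.
have [sVG nVG] := andP nsVG.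
have [M defM sVM nsMG] := inv_quotientN nsVG nsM1.
have [K defK sVK nsKG] := inv_quotientN nsVG nsK1.
have sH1G := subset_trans sHK1 (normal_sub nsK1).
have [H defH sVH sHG] := inv_quotientS nsVG sH1G.
have [x0 Nx0 Gx0 def_x1] := morphimP Gx1.
have sMH : M \subset H.
  move: sMH1; rewrite defM defH quotientSGK //.
  exact: subset_trans (normal_sub nsMG) nVG.
have sHK : H \subset K.
  by move: sHK1; rewrite defH defK quotientSGK // (subset_trans sHG).
have pKM : p.-group (K / M).
  have nsMK := normalS (subset_trans sMH sHK) (normal_sub nsKG) nsMG.
  have nsVK := normalS sVK (normal_sub nsKG) nsVG.
  by move: pKM1; rewrite defM defK (isog_pgroup _ (third_isog sVM nsVK nsMK)).
have Gx : x0.`_p^' \in G by rewrite groupX.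
have Nx := subsetP nVG _ Gx.
(* The p'-part of any preimage of x1 is again a preimage of x1. *)
have nHx := secG p M H K _ nsMG nsKG sMH sHK pKM Gx (p_elt_constt _ _).
have -> : x1 = coset V x0.`_p^'.
  by rewrite def_x1 morph_constt // constt_p_elt // -def_x1.
by rewrite defH (subsetP (quotient_norm _ _)) // mem_quotient.
Qed.

End Structure.

(** Induction on #|G|, over all group types at once since the step passes to a
    quotient G / V. The inclusion of 'O_p(G) in its commutator with G is needed
    to lift the conclusion from G / V: it shows that a Sylow p-subgroup P of G
    lies in V * [~: P, G]. *)
Lemma Sylow_structure p :
    prime p -> forall n (gT : finGroupType) (G : {group gT}),
    #|G| < n -> solvable G -> p'elts_normalize_psections G ->
    ~~ p.-group (G / 'O_p^'(G)) ->
  [/\ p.-Sylow(G) 'O_p(G), 'O_p(G) \subset [~: 'O_p(G), G] &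
      forall H : {group gT}, H \subset 'O_p(G) -> H <| G].
Proof.
move=> p_pr; elim=> // n IHn gT G leGn solG secG p'G.
have [N1|ntN] := eqVneq 'O_p^'(G) 1.
  apply: pcore_structure => //.
  by move: p'G; rewrite N1 -(isog_pgroup p (quotient1_isog G)).
have [V minV sVN] := minnormal_exists ntN (normal_norm (pcore_normal p^' G)).
have sVG : V \subset G := subset_trans sVN (pcore_sub _ _).
have [nVG ntV /is_abelemP[q q_pr abV]] := minnormal_solvable minV sVG solG.
have nsVG : V <| G by rewrite /normal sVG.
have qV := abelem_pgroup abV.
have p'V : p^'.-group V := pgroupS sVN (pcore_pgroup _ _).
have nqp : q != p.
  have [_ qdvV _] := pgroup_pdiv qV ntV.
  by have /pgroupP/(_ q q_pr qdvV) := p'V.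
have [||||sylF sFF nF] := IHn _ (G / V)%G.
- by rewrite -ltnS (leq_trans _ leGn) // ltnS ltn_quotient.
- exact: quotient_sol.
- exact: psections_quotient.
- rewrite pquotient_pcore //.
  by rewrite (isog_pgroup p (third_isog sVN nsVG (pcore_normal _ _))).
have [P sylP] := Sylow_exists p G.
have [sPG pP] := (pHall_sub sylP, pHall_pgroup sylP).
have nVP := subset_trans sPG nVG.
have defPV : P / V = 'O_p(G / V).
  exact: (eq_Hall_pcore sylF (quotient_pHall nVP sylP)).
have sPVR : P \subset V * [~: P, G].
  by rewrite -quotientSK // quotientR // defPV.
(* The elements of P act on V as scalars. *)
have cVR : [~: P, G] \subset 'C(V).
  rewrite gen_subG; apply/subsetP=> _ /imset2P[y g Py Gg ->].
  apply: (abelem_power_commg_cent abV); last exact: (subsetP nVG).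
  move=> H sHV; apply: (psections_norm_psubgroup secG nsVG qV sHV).
    exact: (subsetP sPG).
  by apply: pgroup_p'elt pP Py; rewrite eq_sym.
have cVP : P \subset 'C(V).
  by apply: subset_trans sPVR (mul_subG _ cVR); apply: abelem_abelian abV.
have nG (H : {group gT}) : H \subset P -> H <| G.
  move=> sHP; have sHG := subset_trans sHP sPG.
  have nVH := subset_trans sHP nVP.
  have cVH := subset_trans sHP cVP.
  have nsVHG : V <*> H <| G.
    have := nF (H / V)%G; rewrite /= -defPV quotientS // => /(_ isT) nsHV.
    rewrite -(quotientGK nsVG) -(quotientYK nVH).
    by rewrite cosetpre_normal.
  have nsH : H <| V <*> H.
    by rewrite /normal joing_subr join_subG normG cents_norm // centsC.
  have hallH : p.-Hall(V <*> H) H.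
    have defVH := esym (norm_joinEr nVH).
    by have [] := coprime_mulGp_Hall defVH p'V (pgroupS sHP pP).
  rewrite -(normal_Hall_pcore hallH nsH).
  exact: gFnormal_trans.
have defF : 'O_p(G) = P by apply: normal_Hall_pcore (nG P _).
rewrite defF; split=> //.
have sRP : [~: P, G] \subset P by rewrite commg_subl normal_norm ?nG.
rewrite -{1}(setIidPl sPVR) -group_modr // coprime_TIg ?mul1g //.
by rewrite (pnat_coprime pP).
Qed.

Lemma solvable_psections_structure (gT : finGroupType) (G : {group gT}) :
    solvable G -> p'elts_normalize_psections G ->
  p_nilpotent_or_psubgroups_normal G.
Proof.
move=> solG secG p p_pr.
have [pG|p'G] := boolP (p.-group (G / 'O_p^'(G))); first by left.
right=> H pH sHG.
have [sylF _ nF] := Sylow_structure p_pr (ltnSn _) solG secG p'G.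
by rewrite nF // (sub_Hall_pcore sylF).
Qed.

(** * The equivalence *)

Theorem theorem1p6 (gT : finGroupType) (G : {group gT}) :
  let cond1 := forall (p : nat) (H K : {group gT}),
      p \in \pi(G) -> p.-group H -> p.-group K -> H \subset K -> K \subset G ->
      SS_permutable 'N_G(K)%G H in
  let cond2 := forall (p : nat) (H K : {group gT}),
      p \in \pi(G) -> p.-group H -> p.-group K -> H \subset K -> K \subset G ->
      NSS_permutable 'N_G(K)%G H in
  let cond3 := solvable G /\ PST_group G in
  (cond1 <-> cond2) /\ (cond2 <-> cond3).
Proof.
move=> cond1 cond2 cond3.
have c21: cond2 -> cond1.
  move=> c2 p H K piGp pH pK sHK sKG.
  have [sHN [L [_ supL permL]]] := c2 p H K piGp pH pK sHK sKG.
  by split=> //; exists L.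
have c13: cond1 -> cond3.
  move/SS_p'elts_normalize_psubgroups => yG.
  have solG := p'elts_normalize_psubgroups_sol yG.
  split=> //; apply: p_nilpotent_or_normal_PST.
  apply: solvable_psections_structure => //.
  exact: p'elts_normalize_psections_of_psubgroups.
have c32: cond3 -> cond2.
  move=> [solG pstG] p H K piGp pH pK sHK sKG; apply: p'elts_NSS pK sHK sKG.
  apply: p_nilpotent_or_normal_p'elts.
  apply: solvable_psections_structure => //.
  exact: PST_p'elts_normalize_psections.
by split; split; auto.
Qed.
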